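(* Let $n\ge2$ and $x,y\in[0,1[$. Then: (1) $\rho_x$ and $\rho_y$ are unitarily equivalent representations of $V_n$ if and only if $\mathrm{orb}(x)=\mathrm{orb}(y)$; (2) $\rho_x$ is an irreducible representation of $V_n$ on $H_x$.
   Context: $f(y)=ny\bmod1$ on $[0,1[$; $\mathrm{orb}(x)=\{y\in[0,1[:\ f^p(y)=f^q(x)\text{ for some }p,q\in\mathbb{N}\}$; $H_x=\ell^2(\mathrm{orb}(x))$ with orthonormal basis $\{\delta_y\}$; $S_i\delta_y=\delta_{(y+i-1)/n}$ ($1\le i\le n$); $\pi_x:\mathcal{O}_n\to B(H_x)$ is the representation of the Cuntz algebra ($\sum_j s_js_j^*=1$, $s_i^*s_j=\delta_{ij}1$) with $\pi_x(s_i)=S_i$. For a word $u=u_1\cdots u_r$ over $\{1,\dots,n\}$, $\phi(u)=\big[\sum_i\frac{u_i-1}{n^i},\sum_i\frac{u_i-1}{n^i}+n^{-r}\big[$ and $s_u=s_{u_1}\cdots s_{u_r}$. $V_n$ is the group of bijections $g$ of $[0,1[$ for which there are admissible languages (finite sets of words such that every infinite word has exactly one of them as prefix) $\{a_1,\dots,a_r\}$, $\{b_1,\dots,b_r\}$ with $g$ mapping $\phi(b_i)$ onto $\phi(a_i)$ by the increasing affine map; $\Psi_n(g)=\sum_i s_{a_i}s_{b_i}^*$, and $\rho_x=\pi_x\circ\Psi_n$, a unitary representation of $V_n$ on $H_x$. Two representations $\rho_1,\rho_2$ of a group $G$ on $H_1,H_2$ are unitarily equivalent if there is a unitary $U:H_1\to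 H_2$ with $U\rho_1(g)=\rho_2(g)U$ for all $g$; irreducible means the commutant of $\rho(G)$ is $\mathbb{C}1$. *)

(* Defs.v *)
From HB Require Import structures.
From mathcomp Require Import all_boot all_order all_algebra.
From mathcomp Require Import all_classical all_reals.
From mathcomp Require Import ereal esum.
From mathcomp Require Import complex.

Set Implicit Arguments.
Unset Strict Implicit.
Unset Printing Implicit Defensive.

Import Order.TTheory GRing.Theory Num.Theory.
Local Open Scope classical_set_scope.
Local Open Scope ring_scope.

Section Cuntz.
Variable R : realType.
Local Notation C := (R[i]).

Definition I01 : set R := [set t | 0 <= t < 1].

Definition fmap (n : nat) (y : R) : R :=
  n%:R * y - (Num.floor (n%:R * y))%:~R.

Definition orb (n : nat) (x : R) : set R :=
  [set y | I01 y /\ exists p q : nat, iter p (fmap n) y = iter q (fmap n) x].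

(* vectors: functions R -> C; H_x = l^2(orb x) is the set of square-summable
   functions supported in orb x *)
Definition vect := R -> C.

Definition sqnorm (z : C) : R := (complex.Re z) ^+ 2 + (complex.Im z) ^+ 2.

Definition l2norm2 (xi : vect) : \bar R :=
  \esum_(z in [set: R]) (sqnorm (xi z))%:E.

Definition Hsp (n : nat) (x : R) : set vect :=
  [set xi | (forall z, ~ orb n x z -> xi z = 0) /\ (l2norm2 xi < +oo)%E].

Definition vadd (xi eta : vect) : vect := fun z => xi z + eta z.
Definition vscale (c : C) (xi : vect) : vect := fun z => c * xi z.

(* Generators of O_n acting on H_x.  Letters are coded 0..n-1 (letter d
   stands for the paper's letter d+1).
   S_{d+1} delta_y = delta_{(y+d)/n} :
     (S_{d+1} xi)(z) = xi(n z - d) if z in [d/n,(d+1)/n[, 0 otherwise. *)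
Definition Sop (n d : nat) (xi : vect) : vect :=
  fun z => if (d%:R / n%:R <= z) && (z < d.+1%:R / n%:R)
           then xi (n%:R * z - d%:R) else 0.

(* the adjoint S_{d+1}^* delta_z = delta_{n z - d} if z in [d/n,(d+1)/n[, 0 else:
     (S_{d+1}^* xi)(y) = xi((y+d)/n) for y in [0,1[, 0 otherwise. *)
Definition Sstar (n d : nat) (xi : vect) : vect :=
  fun y => if (0 <= y) && (y < 1) then xi ((y + d%:R) / n%:R) else 0.

Definition word := seq nat.
Definition wf_word (n : nat) (u : word) : bool := all (fun d => (d < n)%N) u.

Definition Sw (n : nat) (u : word) (xi : vect) : vect :=
  foldr (fun d acc => Sop n d acc) xi u.
Definition Sstarw (n : nat) (u : word) (xi : vect) : vect :=
  foldl (fun acc d => Sstar n d acc) xi u.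

Definition phi_left (n : nat) (u : word) : R :=
  \sum_(k < size u) (nth 0%N u k)%:R / (n%:R ^+ k.+1).
Definition phi (n : nat) (u : word) : set R :=
  [set t | phi_left n u <= t < phi_left n u + (n%:R ^+ size u)^-1].

Definition inf_word (n : nat) (w : nat -> nat) : Prop := forall k, (w k < n)%N.
Definition is_prefix (u : word) (w : nat -> nat) : Prop :=
  forall k, (k < size u)%N -> nth 0%N u k = w k.

Definition admissible (n : nat) (L : seq word) : Prop :=
  all (wf_word n) L /\
  forall w, inf_word n w ->
    exists! i : nat, (i < size L)%N /\ is_prefix (nth [::] L i) w.

(* g maps phi(b_i) onto phi(a_i) by the increasing affine map *)
Definition represents (n : nat) (g : R -> R) (a b : seq word) : Prop :=
  size a = size b /\ admissible n a /\ admissible n b /\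
  forall i, (i < size a)%N -> forall t, phi n (nth [::] b i) t ->
    g t = phi_left n (nth [::] a i)
          + (t - phi_left n (nth [::] b i))
            * (n%:R ^+ size (nth [::] b i)) / (n%:R ^+ size (nth [::] a i)).

Definition inVn (n : nat) (g : R -> R) : Prop :=
  (forall t, I01 t -> I01 (g t)) /\
  (forall s t, I01 s -> I01 t -> g s = g t -> s = t) /\
  (forall s, I01 s -> exists2 t, I01 t & g t = s) /\
  exists a b, represents n g a b.

(* a chosen pair of admissible languages representing g (Psi_n(g) does not
   depend on the choice) *)
Definition langs (n : nat) (g : R -> R) : seq word * seq word :=
  match pselect (exists p : seq word * seq word, represents n g p.1 p.2) with
  | left h => projT1 (cid h)
  | right _ => ([::], [::])
  end.

(* rho_x(g) = pi_x(Psi_n(g)) = sum_i S_{a_i} S_{b_i}^* *)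
Definition rho (n : nat) (g : R -> R) (xi : vect) : vect :=
  fun z => \sum_(k < size (langs n g).1)
             Sw n (nth [::] (langs n g).1 k)
                (Sstarw n (nth [::] (langs n g).2 k) xi) z.

Definition lin_on (H H' : set vect) (T : vect -> vect) : Prop :=
  (forall xi, H xi -> H' (T xi)) /\
  (forall c xi eta, H xi -> H eta ->
     T (vadd (vscale c xi) eta) = vadd (vscale c (T xi)) (T eta)).

Definition unitary_on (H H' : set vect) (U : vect -> vect) : Prop :=
  lin_on H H' U /\
  (forall xi, H xi -> l2norm2 (U xi) = l2norm2 xi) /\
  (forall eta, H' eta -> exists2 xi, H xi & U xi = eta).

Definition bounded_on (H : set vect) (T : vect -> vect) : Prop :=
  lin_on H H T /\
  exists M : R, forall xi, H xi -> (l2norm2 (T xi) <= M%:E * l2norm2 xi)%E.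

Definition unit_equiv (n : nat) (x y : R) : Prop :=
  exists U, unitary_on (Hsp n x) (Hsp n y) U /\
    forall g, inVn n g -> forall xi, Hsp n x xi -> U (rho n g xi) = rho n g (U xi).

Definition irreducible (n : nat) (x : R) : Prop :=
  forall T, bounded_on (Hsp n x) T ->
    (forall g, inVn n g -> forall xi, Hsp n x xi -> T (rho n g xi) = rho n g (T xi)) ->
    exists c : C, forall xi, Hsp n x xi -> T xi = vscale c xi.

End Cuntz.

(* Main.v *)
Require Import Defs.
From mathcomp Require Import all_boot all_order all_algebra.
From mathcomp Require Import all_classical all_reals.
From mathcomp Require Import ereal esum complex ring lra.

Set Implicit Arguments.
Unset Strict Implicit.
Unset Printing Implicit Defensive.

Import Defs Order.TTheory GRing.Theory Num.Theory.
Local Open Scope classical_set_scope.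
Local Open Scope ring_scope.

(** Under the identification of V_n with exchanges of n-adic cylinders, [rho n g]
    is the permutation operator [delta t |-> delta (g t)].  For distinct [w] and
    [z], exchanging small neighbouring cylinders near [z] gives elements of V_n
    fixing [w] and moving [z] to infinitely many points; hence a square-summable
    vector invariant under the stabilizer of [w] is supported on [{w}].  So any
    intertwiner [T] maps [delta w] to a multiple of itself.  If [orb x] and
    [orb y] differ they are disjoint, and an intertwiner between them kills
    [delta x], so it is not isometric.  If they agree, [w] and [fmap n w] are
    always related by an element of V_n, so the multiple is constant along the
    orbit, and [T] is scalar by boundedness and density of finite supports. *)

(** * Admissible languages *)

Definition prefixb (w : nat -> nat) (u : word) : bool := u == mkseq w (size u).

Lemma prefixbP (w : nat -> nat) (u : word) : reflect (is_prefix u w) (prefixb w u).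
Proof.
apply: (iffP eqP) => [-> k | h].
  by rewrite size_mkseq => ku; rewrite nth_mkseq.
apply: (@eq_from_nth _ 0%N); first by rewrite size_mkseq.
by move=> k ku; rewrite h // nth_mkseq.
Qed.

Lemma count1_unique_index (T : Type) (x0 : T) (p : pred T) (P : T -> Prop)
    (s : seq T) : (forall x, reflect (P x) (p x)) -> count p s = 1%N ->
  exists! i : nat, (i < size s)%N /\ P (nth x0 s i).
Proof.
move=> pP; elim: s => [//|a s IH] /=.
case: (pP a) => [Pa|nPa] /=.
  rewrite -[RHS]addn0 => /addnI /eqP; rewrite -leqn0 leqNgt -has_count => hs.
  exists 0%N; split => // -[|i] [] //=; rewrite ltnS => i_s Pi.
  by case/negP: hs; apply/(has_nthP x0); exists i => //; apply/pP.
rewrite add0n => /IH[i [[i_s Pi] iU]].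
exists i.+1; split => // -[|j] [] //= j_s Pj.
by congr _.+1; apply: iU.
Qed.

(** Counting form of [admissible]: unlike a unique index, a count is invariant under permutation and
    additive under concatenation. *)
Definition prefix_code (n : nat) (L : seq word) : Prop :=
  all (wf_word n) L /\ forall w, inf_word n w -> count (prefixb w) L = 1%N.

Lemma prefix_code_admissible n L : prefix_code n L -> admissible n L.
Proof.
move=> [wfL cL]; split => // w /cL c1.
exact: (count1_unique_index [::] (prefixbP w) c1).
Qed.

Lemma prefix_code_perm n (L L' : seq word) :
  perm_eq L L' -> prefix_code n L -> prefix_code n L'.
Proof.
move=> /permP LL' [wfL cL]; split; last by move=> w /cL; rewrite LL'.
by move: wfL; rewrite !all_count LL' => /eqP ->; rewrite -!(count_predT) LL'.
Qed.

Definition children (n : nat) (u : word) : seq word :=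
  [seq rcons u d | d <- iota 0 n].

Lemma mem_children n u d : (d < n)%N -> rcons u d \in children n u.
Proof. by move=> dn; apply/map_f; rewrite mem_iota. Qed.

Lemma prefixb_rcons w u d :
  prefixb w (rcons u d) = prefixb w u && (d == w (size u)).
Proof. by rewrite /prefixb size_rcons mkseqS eqseq_rcons. Qed.

(** Exactly one letter extends a prefix [u] of [w], namely [w (size u)], and it occurs once in
    [iota 0 n]. *)
Lemma count_children n w u : inf_word n w ->
  count (prefixb w) (children n u) = prefixb w u.
Proof.
move=> wn; rewrite /children count_map.
rewrite (eq_count (a2 := fun d => prefixb w u && (d == w (size u)))); last first.
  by move=> d /=; rewrite prefixb_rcons.
case: (prefixb w u) => /=; last by rewrite count_pred0.
have := count_uniq_mem (w (size u)) (iota_uniq 0 n).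
by rewrite mem_iota /= add0n wn.
Qed.

Lemma wf_children n u : wf_word n u -> all (wf_word n) (children n u).
Proof.
move=> un; apply/allP => v /mapP[d]; rewrite mem_iota /= => dn ->.
by rewrite /wf_word all_rcons dn.
Qed.

Lemma prefix_code_nil n : prefix_code n [:: [::]].
Proof. by split. Qed.

Lemma prefix_code_split n L u : u \in L -> prefix_code n L ->
  prefix_code n (children n u ++ rem u L).
Proof.
move=> uL cL; have /= [wfL cwL] := prefix_code_perm (perm_to_rem uL) cL.
case/andP: wfL => wfu wfr; split; first by rewrite all_cat wf_children.
move=> w wn; rewrite count_cat count_children //; exact: cwL.
Qed.

Lemma prefix_code_split_all n L : prefix_code n L ->
  prefix_code n (flatten [seq children n u | u <- L]).
Proof.
move=> [wfL cL]; split.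
  apply/allP => v /flatten_mapP[u uL]; move: v; apply/allP/wf_children.
  exact: (allP wfL).
move=> w wn; rewrite -(cL w wn) count_flatten -map_comp.
elim: L {wfL cL} => //= u L ->; by rewrite count_children.
Qed.

(** Supplies, around any point of [0,1[, a cylinder of prescribed length n^-M. *)
Lemma prefix_code_level n M :
  exists2 L, prefix_code n L & {in L, forall u, size u = M}.
Proof.
elim: M => [|M [L cL sL]].
  by exists [:: [::]]; [exact: prefix_code_nil | move=> u; rewrite inE => /eqP ->].
exists (flatten [seq children n u | u <- L]); first exact: prefix_code_split_all.
by move=> v /flatten_mapP[u uL] /mapP[d _ ->]; rewrite size_rcons sL.
Qed.

(** * Cylinders and expansions in base n *)

Section Cylinders.
Variables (R : realType) (n : nat).
Hypothesis n2 : (2 <= n)%N.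
Implicit Types (u v : word) (t s : R) (g : R -> R).

Let n_gt0 : (0 < n%:R :> R).
Proof. by rewrite ltr0n; apply: leq_trans n2. Qed.
Let n_neq0 : (n%:R != 0 :> R). Proof. exact: lt0r_neq0. Qed.
Let N_gt0 M : 0 < n%:R ^+ M :> R. Proof. exact: exprn_gt0. Qed.
Let N_neq0 M : n%:R ^+ M != 0 :> R. Proof. exact: lt0r_neq0. Qed.

(** Both affine maps are total on the reals, so they cancel without range conditions; membership in
    the cylinder is then a condition on [cyl_out] alone. *)
Definition cyl_in u t : R := phi_left R n u + t / n%:R ^+ size u.
Definition cyl_out u t : R := (t - phi_left R n u) * n%:R ^+ size u.

Lemma cyl_inK u : cancel (cyl_in u) (cyl_out u).
Proof. by move=> t; rewrite /cyl_in /cyl_out; field. Qed.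

Lemma cyl_outK u : cancel (cyl_out u) (cyl_in u).
Proof. by move=> t; rewrite /cyl_in /cyl_out; field. Qed.

Lemma phi_left_cons d u :
  phi_left R n (d :: u) = (phi_left R n u + d%:R) / n%:R.
Proof.
rewrite /phi_left big_ord_recl /= expr1 addrC mulrDl; congr (_ + _).
rewrite big_distrl /=; apply: eq_bigr => i _.
by rewrite /bump add1n /= add0n (exprS _ i.+1) invfM mulrA mulrAC.
Qed.

Lemma cyl_out_cons d u t : cyl_out (d :: u) t = cyl_out u (n%:R * t - d%:R).
Proof. by rewrite /cyl_out phi_left_cons /= exprS; field. Qed.

Lemma cyl_in_cons d u t : cyl_in (d :: u) t = (cyl_in u t + d%:R) / n%:R.
Proof. by rewrite /cyl_in phi_left_cons /= exprS; field; rewrite n_neq0 N_neq0. Qed.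

Lemma cyl_out_nil t : cyl_out [::] t = t.
Proof. by rewrite /cyl_out /phi_left big_ord0 expr0 subr0 mulr1. Qed.

Lemma cyl_in_nil t : cyl_in [::] t = t.
Proof. by rewrite /cyl_in /phi_left big_ord0 expr0 add0r divr1. Qed.

Lemma phiE u t : phi n u t <-> I01 (cyl_out u t).
Proof.
rewrite /phi /I01 /cyl_out /=.
have -> : (0 <= (t - phi_left R n u) * n%:R ^+ size u) = (phi_left R n u <= t).
  by rewrite pmulr_lge0 // subr_ge0.
have -> // : ((t - phi_left R n u) * n%:R ^+ size u < 1)
   = (t < phi_left R n u + (n%:R ^+ size u)^-1).
by rewrite -ltr_pdivlMr // div1r ltrBlDl.
Qed.

Lemma phi_cyl_in u t : phi n u (cyl_in u t) <-> I01 t.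
Proof. by rewrite phiE cyl_inK. Qed.

Lemma phi_cons d u t : phi n (d :: u) t <-> phi n u (n%:R * t - d%:R).
Proof. by rewrite !phiE cyl_out_cons. Qed.

Lemma I01_digit d t : (d < n)%N -> I01 (n%:R * t - d%:R) -> I01 t.
Proof.
move=> dn /andP[h0 h1]; have d0 : 0 <= d%:R :> R by [].
have d1 : d%:R + 1 <= n%:R :> R by rewrite natr1 ler_nat.
apply/andP; split.
  by rewrite -(pmulr_rge0 _ n_gt0); lra.
by rewrite -(ltr_pM2l n_gt0); lra.
Qed.

Lemma phi_I01 u t : wf_word n u -> phi n u t -> I01 t.
Proof.
elim: u t => [|d u IH] t; first by rewrite phiE cyl_out_nil.
by move=> /andP[dn wu] /phi_cons /(IH _ wu); exact: I01_digit.
Qed.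

Lemma cyl_in_I01 u t : wf_word n u -> I01 t -> I01 (cyl_in u t).
Proof. by move=> wu t01; apply: (phi_I01 wu); apply/phi_cyl_in. Qed.

(** For [t] in [0,1[, the base-n digits of [t], indexed from 0 and read off its orbit under
    [fmap]. *)
Definition dig t (k : nat) : nat := Num.truncn (n%:R * iter k (fmap n) t).

Lemma fmap_I01 t : I01 (fmap n t).
Proof.
have /andP[h1 h2] := floor_itv (n%:R * t); rewrite intrD in h2.
by apply/andP; rewrite /fmap; split; lra.
Qed.

Lemma iter_fmap_I01 k t : I01 t -> I01 (iter k (fmap n) t).
Proof. by case: k => [//|k] _; exact: fmap_I01. Qed.

Lemma fmapE t : I01 t -> fmap n t = n%:R * t - (dig t 0)%:R.
Proof.
move=> /andP[t0 t1]; rewrite /fmap /dig /= truncn_floor ?mulr_ge0 //.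
have : (0 <= Num.floor (n%:R * t)) by rewrite floor_ge0 mulr_ge0.
by case: (Num.floor _).
Qed.

Lemma dig_lt t : I01 t -> inf_word n (dig t).
Proof.
move=> t01 k; have /andP[h0 h1] := iter_fmap_I01 k t01.
rewrite -(ltr_nat R); apply: (@le_lt_trans _ _ (n%:R * iter k (fmap n) t)).
  by have /andP[] := truncn_itv (mulr_ge0 (ltW n_gt0) h0).
by rewrite -[ltRHS]mulr1 ltr_pM2l.
Qed.

Lemma dig0P t d : I01 t -> I01 (n%:R * t - d%:R) -> dig t 0 = d.
Proof.
move=> /andP[t0 t1] /andP[h0 h1]; rewrite /dig /=; apply: truncn_def.
by rewrite -natr1; apply/andP; split; lra.
Qed.

(** The bridge from infinite words to real cylinders. Removing the first letter of [u] amounts to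
    applying [fmap] to [t], which shifts the digits by one. *)
Lemma phi_digP u t : wf_word n u -> I01 t ->
  phi n u t <-> is_prefix u (dig t).
Proof.
elim: u t => [|d u IH] t wu t01.
  by rewrite phiE cyl_out_nil; split.
case/andP: wu => dn wu; rewrite phi_cons.
have digS k : dig t k.+1 = dig (fmap n t) k by rewrite /dig iterSr.
split=> [h | h].
  have d0 := dig0P t01 (phi_I01 wu h).
  move: h; rewrite -d0 -fmapE // (IH _ wu (fmap_I01 t)) => h [|k] //= ku.
  by rewrite digS; apply: h.
have d0 := h 0%N erefl; rewrite /= in d0; rewrite d0 -fmapE //.
apply/(IH _ wu (fmap_I01 t)) => k ku.
by rewrite -digS; exact: (h k.+1).
Qed.

Lemma wf_nth L i : all (wf_word n) L -> wf_word n (nth [::] L i).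
Proof. by move=> wL; case: (ltnP i (size L)) => h; [exact: all_nthP | rewrite nth_default]. Qed.

(** Existence of the index for the infinite word [dig t] gives covering; its uniqueness gives
    disjointness in the next lemma. *)
Lemma admissible_cover L t : admissible n L -> I01 t ->
  exists2 i, (i < size L)%N & phi n (nth [::] L i) t.
Proof.
move=> [wL aL] t01; have [i [[iL pi] _]] := aL _ (dig_lt t01).
by exists i => //; apply/phi_digP => //; apply: wf_nth.
Qed.

Lemma admissible_disjoint L t i j : admissible n L ->
  (i < size L)%N -> (j < size L)%N ->
  phi n (nth [::] L i) t -> phi n (nth [::] L j) t -> i = j.
Proof.
move=> [wL aL] iL jL pi pj; have t01 := phi_I01 (wf_nth i wL) pi.
have [k [_ kU]] := aL _ (dig_lt t01).
by rewrite -(kU i) ?(kU j) //; split => //; apply/phi_digP => //; exact: wf_nth.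
Qed.

(** * Elements of V_n as exchanges of cylinders *)

(** The index is obtained by choice; when [b] is admissible, disjointness makes it unique. Points in
    no cylinder of [b] stay fixed. *)
Definition code_map (a b : seq word) t : R :=
  if pselect (exists2 i, (i < size b)%N & phi n (nth [::] b i) t) is left h
  then let i := projT1 (cid2 h) in cyl_in (nth [::] a i) (cyl_out (nth [::] b i) t)
  else t.

Lemma code_mapE a b i t : admissible n b -> (i < size b)%N ->
  phi n (nth [::] b i) t ->
  code_map a b t = cyl_in (nth [::] a i) (cyl_out (nth [::] b i) t).
Proof.
move=> ab ib pit; rewrite /code_map; case: pselect => [h|[]]; last by exists i.
case: (cid2 h) => j jb pjt /=.
by rewrite (admissible_disjoint ab jb ib pjt pit).
Qed.

Lemma represents_phi g a b i t : represents n g a b -> (i < size a)%N ->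
  phi n (nth [::] b i) t -> phi n (nth [::] a i) (g t).
Proof.
move=> [_ [_ [_ gE]]] ia pit; rewrite (gE i ia t pit).
by apply/phi_cyl_in; apply/phiE.
Qed.

Lemma code_map_represents a b : size a = size b -> admissible n a ->
  admissible n b -> represents n (code_map a b) a b.
Proof.
move=> sab aa ab; do 3!split => //.
by move=> i ia t pit; rewrite (@code_mapE a b i) // -sab.
Qed.

Lemma code_map_inVn a b : size a = size b -> admissible n a ->
  admissible n b -> inVn n (code_map a b).
Proof.
move=> sab aa ab; have rg := code_map_represents sab aa ab.
have [wa _] := aa; have [wb _] := ab.
split=> [t t01|].
  have [i ib pit] := admissible_cover ab t01; rewrite -sab in ib.
  exact: phi_I01 (wf_nth i wa) (represents_phi rg ib pit).
split=> [s t s01 t01|].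
  have [i ib pis] := admissible_cover ab s01.
  have [j jb pjt] := admissible_cover ab t01 => est.
  (* The common image lies in the [a]-cylinders of index [i] and [j], which are disjoint for
     distinct indices. *)
  have ij : i = j.
    apply: (admissible_disjoint aa (t := code_map a b s)); rewrite ?sab //.
      by apply: (represents_phi rg) => //; rewrite sab.
    by rewrite est; apply: (represents_phi rg) => //; rewrite sab.
  move: est; rewrite -ij in pjt *.
  rewrite (code_mapE a ab ib pis) (code_mapE a ab ib pjt).
  by move/(can_inj (@cyl_inK _))/(can_inj (@cyl_outK _)).
split; last by exists a, b.
move=> s s01; have [i ia pis] := admissible_cover aa s01.
have pt : phi n (nth [::] b i) (cyl_in (nth [::] b i) (cyl_out (nth [::] a i) s)).
  by apply/phi_cyl_in; apply/phiE.
exists (cyl_in (nth [::] b i) (cyl_out (nth [::] a i) s)).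
  exact: phi_I01 (wf_nth i wb) pt.
by rewrite (code_mapE a ab _ pt) -?sab // cyl_inK cyl_outK.
Qed.

(** * The permutation action behind rho *)

Definition supp01 (xi : vect R) : Prop := forall z, ~ I01 z -> xi z = 0.

Lemma Sw_cyl_out u xi z : wf_word n u -> supp01 xi ->
  Sw n u xi z = xi (cyl_out u z).
Proof.
move=> + xi01; elim: u z => [|d u IH] z; first by rewrite cyl_out_nil.
move=> /andP[dn wu]; rewrite cyl_out_cons -IH // /Sw /= -/(Sw n u xi) /Sop.
case: ifPn => // h; rewrite IH //; apply/esym/xi01 => /phiE /(phi_I01 wu).
move=> /andP[h0 h1]; move/negP: h; apply; apply/andP; split.
  by rewrite ler_pdivrMr // mulrC; lra.
by rewrite ltr_pdivlMr // mulrC -natr1; lra.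
Qed.

Lemma Sstarw_cyl_in u xi y : wf_word n u -> supp01 xi ->
  Sstarw n u xi y = if (0 <= y) && (y < 1) then xi (cyl_in u y) else 0.
Proof.
elim: u xi => [|d u IH] xi wu xi01 /=.
  by rewrite cyl_in_nil /Sstarw /=; case: ifPn => // /negP /xi01.
case/andP: wu => dn wu; rewrite /Sstarw /= -/(Sstarw n u _) IH //.
  case: ifP => // y01; rewrite cyl_in_cons /Sstar.
  by have /= -> := cyl_in_I01 wu y01.
by move=> z /negP z01; rewrite /Sstar (negbTE z01).
Qed.

Lemma represents_langs g : inVn n g ->
  represents n g (langs n g).1 (langs n g).2.
Proof.
move=> [_ [_ [_ [a [b rg]]]]]; rewrite /langs.
case: pselect => [h|[]]; last by exists (a, b).
exact: (projT2 (cid h)).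
Qed.

(** If [t] lies in the cylinder of b_i, then [g t] lies in that of a_i. Disjointness kills every
    other term of the sum, so the result does not depend on the pair chosen by [langs]. *)
Lemma rho_act g xi t : inVn n g -> supp01 xi -> I01 t ->
  rho n g xi (g t) = xi t.
Proof.
move=> gV xi01 t01; have := represents_langs gV.
rewrite /rho; case: (langs n g) => a b /= rg.
have [sab [aa [ab gE]]] := rg; have [wa _] := aa; have [wb _] := ab.
have [i ib pit] := admissible_cover ab t01.
have ia : (i < size a)%N by rewrite sab.
have pa := represents_phi rg ia pit.
have supp_star v : wf_word n v -> supp01 (Sstarw n v xi).
  by move=> wv z /negP z01; rewrite Sstarw_cyl_in // (negbTE z01).
rewrite (bigD1 (Ordinal ia)) //= big1 => [|k /eqP ki]; last first.
  rewrite Sw_cyl_out ?wf_nth //; last by apply/supp_star/wf_nth.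
  rewrite Sstarw_cyl_in ?wf_nth //; case: ifP => // h; case: ki.
  apply/val_inj; apply: (admissible_disjoint aa (ltn_ord k) ia _ pa).
  exact/phiE.
rewrite addr0 Sw_cyl_out ?Sstarw_cyl_in ?wf_nth //; last first.
  by apply: supp_star; exact: wf_nth.
have /phiE /= -> := pa.
have -> : g t = cyl_in (nth [::] a i) (cyl_out (nth [::] b i) t) by exact: gE.
by rewrite cyl_inK cyl_outK.
Qed.

Lemma rho_supp g xi : inVn n g -> supp01 xi -> supp01 (rho n g xi).
Proof.
move=> gV xi01 z z01; have := represents_langs gV.
rewrite /rho; case: (langs n g) => a b /= [_ [[wa _] [[wb _] _]]].
apply: big1 => k _.
have supp_star v : wf_word n v -> supp01 (Sstarw n v xi).
  by move=> wv s /negP s01; rewrite Sstarw_cyl_in // (negbTE s01).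
rewrite Sw_cyl_out ?wf_nth //; last by apply/supp_star/wf_nth.
apply: supp_star; first exact: wf_nth.
by move=> /phiE /(phi_I01 (wf_nth k wa)).
Qed.

(** * Enough elements of V_n *)

Lemma phi_mem_level L t : prefix_code n L -> I01 t ->
  exists2 u, u \in L & phi n u t.
Proof.
move=> /prefix_code_admissible aL t01.
have [i iL pit] := admissible_cover aL t01.
by exists (nth [::] L i) => //; exact: mem_nth.
Qed.

(** Put [u] and [v] at the heads of their codes and match the remaining words arbitrarily; only the
    sizes have to agree. *)
Lemma code_map_exchange u v (A B : seq word) t :
  prefix_code n A -> prefix_code n B -> size A = size B -> u \in A -> v \in B ->
  phi n v t -> exists2 g, inVn n g & g t = cyl_in u (cyl_out v t).
Proof.
move=> cA cB sAB uA vB pvt.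
have aA := prefix_code_admissible (prefix_code_perm (perm_to_rem uA) cA).
have aB := prefix_code_admissible (prefix_code_perm (perm_to_rem vB) cB).
exists (code_map (u :: rem u A) (v :: rem v B)).
  by apply: code_map_inVn => //; rewrite -!(perm_size (perm_to_rem _)).
by rewrite (@code_mapE _ _ 0%N).
Qed.

Lemma phi_left_rcons u d :
  phi_left R n (rcons u d) = phi_left R n u + d%:R / n%:R ^+ (size u).+1.
Proof.
rewrite /phi_left size_rcons big_ord_recr /= nth_rcons ltnn eqxx; congr (_ + _).
by apply: eq_bigr => i _; rewrite nth_rcons ltn_ord.
Qed.

Lemma phi_rcons u d t : (d < n)%N -> phi n (rcons u d) t -> phi n u t.
Proof.
move=> dn; rewrite /phi /= phi_left_rcons size_rcons => /andP[h0 h1].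
have e : n%:R * n%:R ^- (size u).+1 = n%:R ^- size u :> R.
  by rewrite exprS invfM mulVKf.
have d1 : d%:R + 1 <= n%:R :> R by rewrite natr1 ler_nat.
have N0 : 0 < n%:R ^- (size u).+1 :> R by rewrite invr_gt0.
have d0 : 0 <= d%:R * n%:R ^- (size u).+1 :> R by rewrite mulr_ge0 // ltW.
have : (d%:R + 1) * n%:R ^- (size u).+1 <= n%:R * n%:R ^- (size u).+1 :> R.
  by rewrite ler_wpM2r // ltW.
by rewrite e mulrDl mul1r => d2; apply/andP; split; lra.
Qed.

(* Exchanging two neighbouring cylinders below that of [z] fixes every point
   outside the latter. *)
Lemma inVn_shift M (w z : R) : I01 w -> I01 z -> n%:R ^- M <= `|w - z| ->
  exists2 g, inVn n g & g w = w /\ `|g z - z| = n%:R ^- M.+1.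
Proof.
move=> w01 z01 wz.
have [L cL sL] := prefix_code_level n M.
have [v vL pv] := phi_mem_level cL z01.
have sv := sL _ vL; have [wL _] := cL; have wv := allP wL v vL.
(* The cylinder of [v] is half-open of length n^-M, so two of its points are less than n^-M
   apart. *)
have nw : ~ phi n v w.
  rewrite /phi /= sv in pv * => /andP[h1 h2]; case/andP: pv => h3 h4.
  by move: wz; rewrite leNgt => /negP; apply; rewrite ltr_norml; apply/andP; split; lra.
have cS := prefix_code_split vL cL.
have [d dn pd] : exists2 d, (d < n)%N & phi n (rcons v d) z.
  exists (dig z M); first exact: dig_lt.
  have vp := (phi_digP wv z01).1 pv.
  apply/phi_digP => //.
    by rewrite /wf_word all_rcons (dig_lt z01).
  apply/prefixbP; rewrite prefixb_rcons sv eqxx andbT; exact/prefixbP.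
(* A letter adjacent to [d], so that the displacement is exactly n^-(M+1); the letter 1 is available
   because n is at least 2. *)
pose d' := if d == 0%N then 1%N else d.-1.
have d'n : (d' < n)%N by rewrite /d'; case: ifP => _ //; apply: leq_ltn_trans dn; exact: leq_pred.
have dd' : d' != d by rewrite /d'; case: d {dn pd d' d'n} => //= d; rewrite neq_ltn ltnSn.
pose rest := rem (rcons v d') (rem (rcons v d) (children n v ++ rem v L)).
have pS : perm_eq (children n v ++ rem v L) (rcons v d :: rcons v d' :: rest).
  have m1 : rcons v d \in children n v ++ rem v L by rewrite mem_cat mem_children.
  have m2 : rcons v d' \in rem (rcons v d) (children n v ++ rem v L).
    have : rcons v d' \in children n v ++ rem v L by rewrite mem_cat mem_children.
    rewrite (perm_mem (perm_to_rem m1)) inE => /orP[/eqP /rcons_inj[/eqP]|//].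
    by rewrite (negbTE dd').
  apply: (perm_trans (perm_to_rem m1)); rewrite perm_cons.
  exact: perm_to_rem m2.
set b := rcons v d :: _ in pS.
pose a := rcons v d' :: rcons v d :: rest.
have pa : perm_eq b a by rewrite /a /b -(cat1s (rcons v d)) -(cat1s (rcons v d')) perm_catCA.
have cb := prefix_code_perm pS cS.
have ab := prefix_code_admissible cb.
have aa := prefix_code_admissible (prefix_code_perm pa cb).
exists (code_map a b); first exact: code_map_inVn.
split.
  have [i ib pi] := admissible_cover ab w01.
  rewrite (code_mapE a ab ib pi).
  (* Indices 0 and 1 are the swapped cylinders, both inside that of [v]; from index 2 on [a] and [b]
     agree. *)
  case: i ib pi => [|[|i]] /= ib pi; last by rewrite cyl_outK.
    by case: nw; exact: phi_rcons pi.
  by case: nw; exact: phi_rcons pi.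
rewrite (@code_mapE a b 0%N) //= /cyl_in /cyl_out !phi_left_rcons !size_rcons sv.
have -> : phi_left R n v + d'%:R / n%:R ^+ M.+1 +
  (z - (phi_left R n v + d%:R / n%:R ^+ M.+1)) * n%:R ^+ M.+1 / n%:R ^+ M.+1 - z
  = (d'%:R - d%:R) * n%:R ^- M.+1 by rewrite mulfK //; ring.
rewrite normrM [X in _ * X]ger0_norm ?invr_ge0 ?ltW //.
have -> : `|d'%:R - d%:R| = 1 :> R; last by rewrite mul1r.
rewrite /d'; case: d {dn pd d' d'n dd' rest pS b a pa cb ab aa} => [|d] /=.
  by rewrite subr0 normr1.
by rewrite -natr1 opprD addrA subrr add0r normrN normr1.
Qed.

(** Although [fmap] is not injective, it maps the cylinder of [[:: d; e]] affinely onto that of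
    [[:: e]]. This piece extends to an element of V_n once the two words sit in codes of equal
    size. *)
Lemma inVn_fmap (w : R) : I01 w -> exists2 g, inVn n g & g w = fmap n w.
Proof.
move=> w01; have cN := @prefix_code_nil n.
have cL := prefix_code_split_all cN; rewrite /= cats0 in cL.
set L := children n [::] in cL.
pose d := dig w 0; pose e := dig w 1.
have dn : (d < n)%N by exact: dig_lt.
have en : (e < n)%N by exact: dig_lt.
(* Splitting a letter other than [e] keeps [[:: e]] in the first code and gives it the same size as
   the second, where [d] is split. *)
pose e' := if e == 0%N then 1%N else 0%N.
have e'n : (e' < n)%N by rewrite /e'; case: ifP => // _; exact: leq_trans n2.
have ee' : e' != e by rewrite /e'; case: (e).
have mL k : (k < n)%N -> [:: k] \in L by move=> kn; exact: (mem_children [::]).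
have cA := prefix_code_split (mL _ e'n) cL.
have cB := prefix_code_split (mL _ dn) cL.
have sz k : (k < n)%N -> size (children n [:: k] ++ rem [:: k] L) = (n + n.-1)%N.
  by move=> kn; rewrite size_cat size_rem ?mL // !size_map size_iota.
have mB : [:: d; e] \in children n [:: d] ++ rem [:: d] L.
  by rewrite mem_cat (mem_children [:: d] en).
have mA : [:: e] \in children n [:: e'] ++ rem [:: e'] L.
  have := mL _ en; rewrite mem_cat (perm_mem (perm_to_rem (mL _ e'n))) inE.
  by move=> /orP[/eqP[ee]|->]; [rewrite ee eqxx in ee' | rewrite orbT].
have pw : phi n [:: d; e] w.
  apply/phi_digP => //; first by rewrite /wf_word /= dn en.
  by move=> [|[|]].
have [|g gV gw] := code_map_exchange cA cB _ mA mB pw; first by rewrite !sz.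
exists g => //; rewrite gw cyl_out_cons -/d -fmapE // cyl_outK //.
Qed.

End Cylinders.

(** * Square-summable vectors *)

Section SquareSummable.
Variable R : realType.
Local Notation C := (R[i]).
Implicit Types (xi : vect R) (z w : R) (r : seq R).

Definition delta w : vect R := fun z => (z == w)%:R.
Definition restrict (p : pred R) xi : vect R := fun z => if p z then xi z else 0.

Lemma sqnorm_ge0 (c : C) : 0 <= sqnorm c.
Proof. by rewrite addr_ge0 // sqr_ge0. Qed.

Lemma sqnorm0 : sqnorm (0 : C) = 0.
Proof. by rewrite /sqnorm /= expr0n addr0. Qed.

Lemma sqnorm1 : sqnorm (1 : C) = 1.
Proof. by rewrite /sqnorm /= expr1n expr0n addr0. Qed.

Lemma sqnorm_eq0 (c : C) : sqnorm c = 0 -> c = 0.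
Proof.
case: c => a b; rewrite /sqnorm /= => /eqP.
by rewrite paddr_eq0 ?sqr_ge0 // !sqrf_eq0 => /andP[/eqP -> /eqP ->].
Qed.

Lemma sqnorm_le_l2norm2 xi z : ((sqnorm (xi z))%:E <= l2norm2 xi)%E.
Proof.
apply: esum_ge; exists [set z]; first by split => //; exact: finite_set1.
by rewrite fsbig_set1.
Qed.

Lemma l2norm2_ge0 xi : (0 <= l2norm2 xi)%E.
Proof. by apply: esum_ge0 => z _; rewrite lee_fin sqnorm_ge0. Qed.

Lemma l2norm2_delta w : l2norm2 (delta w) = 1%E.
Proof.
rewrite -(@esum_set1 _ _ w (fun=> 1%E)) ?lee01 // esum_mkcond.
apply: eq_esum => z _; rewrite /delta.
case: eqP => [->|zw]; first by rewrite mem_set // sqnorm1.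
by rewrite memNset // sqnorm0.
Qed.

Lemma l2norm2_restrict_sub (p q : pred R) xi : (forall z, p z -> q z) ->
  (l2norm2 (restrict p xi) <= l2norm2 (restrict q xi))%E.
Proof.
move=> pq; apply: le_esum => z _; rewrite /restrict lee_fin.
case: ifP => [/pq -> //|_]; by rewrite sqnorm0 sqnorm_ge0.
Qed.

Lemma l2norm2_restrict (p : pred R) xi :
  (l2norm2 (restrict p xi) <= l2norm2 xi)%E.
Proof. exact: (@l2norm2_restrict_sub p predT xi). Qed.

(** Any N distinct points contribute N times [sqnorm c] to the finite norm. *)
Lemma l2norm2_const_seq xi (c : C) (t : nat -> R) : injective t ->
  (forall k, xi (t k) = c) -> (l2norm2 xi < +oo)%E -> c = 0.
Proof.
move=> tinj xit xi2; apply: sqnorm_eq0; apply/eqP; rewrite eq_le sqnorm_ge0 andbT.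
have lb N : ((sqnorm c *+ N)%:E <= l2norm2 xi)%E.
  apply: esum_ge; exists [set` [seq t k | k <- iota 0 N]].
    by split => //; exact: finite_seq.
  rewrite -fsbig_seq ?map_inj_uniq ?iota_uniq //= big_map sumEFin lee_fin.
  under eq_bigr do rewrite xit.
  by rewrite big_const_seq count_predT size_iota iter_addr addr0.
have xif : l2norm2 xi \is a fin_num by rewrite ge0_fin_numE // l2norm2_ge0.
rewrite leNgt; apply/negP => c0.
have := lb (Num.truncn (fine (l2norm2 xi) / sqnorm c)).+1.
rewrite -(fineK xif) lee_fin -mulr_natr mulrC -ler_pdivlMr // leNgt.
by rewrite truncnS_gt.
Qed.

(** The norm is a supremum of finite partial sums; a finite set whose sum is within [e] of it leaves
    a complement contributing at most [e]. *)
Lemma l2norm2_tail xi (e : R) : (l2norm2 xi < +oo)%E -> 0 < e ->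
  exists r, (l2norm2 (restrict (fun z => z \notin r) xi) <= e%:E)%E.
Proof.
move=> xi2 e0.
have xif : l2norm2 xi \is a fin_num by rewrite ge0_fin_numE // l2norm2_ge0.
have [_ [A [finA _] <-]] := ub_ereal_sup_adherent e0 xif.
rewrite -/(esum _ _) -/(l2norm2 xi) => lA.
have [r rA] := (finite_seqP A).1 finA; exists r.
have F0 z : (0 <= (sqnorm (xi z))%:E)%E by rewrite lee_fin sqnorm_ge0.
have := esumID A setT (fun z => (sqnorm (xi z))%:E) (fun z _ => F0 z).
rewrite !setTI -/(l2norm2 xi) [X in (X + _)%E]esum_fset //.
have -> : (\esum_(z in ~` A) (sqnorm (xi z))%:E)%E
   = l2norm2 (restrict (fun z => z \notin r) xi).
  rewrite esum_mkcond; apply: eq_esum => z _; rewrite /restrict in_setC rA.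
  have -> : (z \in [set` r]) = (z \in r) by apply/idP/idP; rewrite inE.
  by case: ifP => // _; rewrite sqnorm0.
set S := (\sum_(_ \in _) _)%E in lA *; set E := l2norm2 (restrict _ _).
have E0 : (0 <= E)%E by exact: l2norm2_ge0.
have S0 : (0 <= S)%E by apply: fsume_ge0.
move: lA xif E0 S0; case: (l2norm2 xi) => // l; case: S => // s; case: E => // a.
rewrite -EFinB -EFinD !lte_fin !lee_fin => + _ _ _ [].
by move=> ? ?; lra.
Qed.

End SquareSummable.

(** * Orbits, intertwiners and irreducibility *)

Section Representation.
Variables (R : realType) (n : nat).
Hypothesis n2 : (2 <= n)%N.
Local Notation C := (R[i]).
Implicit Types (xi : vect R) (x y z w : R) (g : R -> R) (T : vect R -> vect R).

Lemma orb_refl x : I01 x -> orb n x x.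
Proof. by move=> x01; split => //; exists 0%N, 0%N. Qed.

Lemma orb_trans x y z : orb n x y -> orb n y z -> orb n x z.
Proof.
move=> [_ [p [q yx]]] [z01 [p' [q' zy]]]; split => //.
exists (p + p')%N, (q' + q)%N.
by rewrite iterD zy -iterD addnC iterD yx -iterD.
Qed.

Lemma orb_sym x y : I01 x -> orb n x y -> orb n y x.
Proof. by move=> x01 [_ [p [q e]]]; split => //; exists q, p. Qed.

Lemma orb_fmap x w : orb n x w -> orb n x (fmap n w).
Proof.
move=> xw; apply: orb_trans xw _; split; first exact: fmap_I01.
by exists 0%N, 1%N.
Qed.

Lemma Hsp_supp01 x xi : Hsp n x xi -> supp01 xi.
Proof. by move=> [h _] z z01; apply: h => -[]. Qed.

Lemma Hsp_delta x w : orb n x w -> Hsp n x (delta w).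
Proof.
move=> xw; split; last by rewrite l2norm2_delta ltry.
by move=> z xz; rewrite /delta; case: eqP => // zw; case: xz; rewrite zw.
Qed.

Lemma Hsp_restrict x (p : pred R) xi : Hsp n x xi -> Hsp n x (restrict p xi).
Proof.
move=> [s l]; split; last exact: le_lt_trans (l2norm2_restrict p xi) l.
by move=> z /s xz; rewrite /restrict xz if_same.
Qed.

Lemma rho_delta g w : inVn n g -> I01 w -> rho n g (delta w) = delta (g w).
Proof.
move=> gV w01; have [gI [ginj [gsur _]]] := gV.
have dw : supp01 (delta w).
  by move=> z z01; rewrite /delta; case: eqP => // zw; case: z01; rewrite zw.
apply/funext => z; have [z01|z01] := pselect (I01 z); last first.
  rewrite (rho_supp n2 gV dw z01) /delta; case: eqP => // zw.
  by case: z01; rewrite zw; exact: gI.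
have [t t01 <-] := gsur _ z01; rewrite (rho_act n2 gV dw t01) /delta.
by congr (_%:R); congr nat_of_bool; apply/eqP/eqP => [->|/ginj ->].
Qed.

(** Invariance repeats the value [xi z] at every [g k z]. These points are distinct because their
    distances n^-(M+k+1) to [z] are, so summability forces the value to be zero. *)
Lemma stabilizer_invariant_vanish xi w z : I01 w -> I01 z -> z != w ->
  supp01 xi -> (l2norm2 xi < +oo)%E ->
  (forall g, inVn n g -> g w = w -> rho n g xi = xi) -> xi z = 0.
Proof.
move=> w01 z01 zw sxi xi2 inv.
have wz0 : 0 < `|w - z| by rewrite normr_gt0 subr_eq0 eq_sym.
have n0 : 0 < n%:R :> R by rewrite ltr0n; apply: leq_trans n2.
(* Chosen above the inverse distance; since M < n^M, cylinders of level M or deeper are no longer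
   than the distance. *)
pose M := (Num.truncn `|w - z|^-1).+1.
have hM k : n%:R ^- (M + k) <= `|w - z|.
  rewrite -[leRHS]invrK lef_pV2 ?posrE ?invr_gt0 ?exprn_gt0 //.
  apply: (@le_trans _ _ M%:R); first by rewrite ltW // truncnS_gt.
  rewrite -natrX ler_nat; apply: leq_trans (leq_addr k M) _.
  exact/ltnW/ltn_expl.
have /choice[g gP] : forall k, exists g,
    [/\ inVn n g, g w = w & `|g z - z| = n%:R ^- (M + k).+1].
  by move=> k; have [g gV [gw gz]] := inVn_shift n2 w01 z01 (hM k); exists g.
apply: (@l2norm2_const_seq _ xi (xi z) (fun k => g k z)) => // [i j eij | k].
  have [_ _ hi] := gP i; have [_ _ hj] := gP j; rewrite eij hj in hi.
  move/invr_inj/eqP: hi; rewrite -!natrX eqr_nat eqn_exp2l // eqSS eqn_add2l.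
  by move/eqP.
have [gV gw _] := gP k; by rewrite -{1}(inv _ gV gw) rho_act.
Qed.

(** The image of [delta w] inherits its invariance under the stabilizer of [w]. Source and target
    may differ, so this serves both equivalence and irreducibility. *)
Lemma intertwiner_delta x y T w z : lin_on (Hsp n x) (Hsp n y) T ->
  (forall g, inVn n g -> forall xi, Hsp n x xi -> T (rho n g xi) = rho n g (T xi)) ->
  orb n x w -> z != w -> T (delta w) z = 0.
Proof.
move=> [TH _] Tg xw zw; have dw := Hsp_delta xw; have Hw := TH _ dw.
have [z01|/(Hsp_supp01 Hw)//] := pselect (I01 z).
have [w01 _] := xw.
apply: (stabilizer_invariant_vanish w01 z01 zw (Hsp_supp01 Hw)).
  by case: Hw.
by move=> g gV gw; rewrite -Tg // rho_delta // gw.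
Qed.

(** If [x] is outside the orbit of [y], then [U (delta x)] vanishes at [x] by its support and
    elsewhere by [intertwiner_delta], against its norm being 1. *)
Lemma unit_equiv_orb x y : I01 x -> I01 y -> unit_equiv n x y -> orb n x = orb n y.
Proof.
move=> x01 y01 [U [[Ulin [Uiso _]] Ug]]; have xx := orb_refl x01.
have [yx|nyx] := pselect (orb n y x).
  apply/seteqP; split => z; first exact: orb_trans.
  move=> yz; apply: orb_trans yz; exact: orb_sym yx.
have dx := Hsp_delta xx.
have U0 z : U (delta x) z = 0.
  have [->|zx] := eqVneq z x; last exact: intertwiner_delta Ulin Ug xx zx.
  by have [s _] := Ulin.1 _ dx; exact: s.
have := Uiso _ dx; rewrite l2norm2_delta /l2norm2 esum1; last first.
  by move=> z _; rewrite U0 sqnorm0.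
by move/eqP; rewrite eq_sym onee_eq0.
Qed.

Lemma unit_equiv_refl x : unit_equiv n x x.
Proof.
exists id; split => //; do 2!split => //; by move=> eta ?; exists eta.
Qed.

Lemma intertwiner_finite x T (c : C) (r : seq R) xi : lin_on (Hsp n x) (Hsp n x) T ->
  (forall w, orb n x w -> T (delta w) = vscale c (delta w)) -> Hsp n x xi ->
  T (restrict (mem r) xi) = vscale c (restrict (mem r) xi).
Proof.
move=> [TH Tlin] Td Hxi; elim: r => [|a r IH].
  have H0 := Hsp_restrict (mem [::]) Hxi.
  have e0 : restrict (mem [::]) xi = (fun=> 0) by apply/funext.
  (* [lin_on] speaks of combinations c xi + eta, so T 0 = 0 is extracted from (-1)f + f = f with f =
     0. *)
  have := Tlin (-1) _ _ H0 H0; set f := restrict _ _ in e0 *.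
  have -> : vadd (vscale (-1) f) f = f.
    by rewrite e0; apply/funext => z; rewrite /vadd /vscale mulr0 addr0.
  move=> Tf; rewrite Tf e0; apply/funext => z.
  by rewrite /vadd /vscale mulN1r addNr mulr0.
have Hr := Hsp_restrict (mem r) Hxi.
(* A repeated entry, or one off the orbit where [xi] is zero, does not change the restriction. *)
have [[ar nxa]|h] := pselect (a \notin r /\ orb n x a); last first.
  have -> // : restrict (mem (a :: r)) xi = restrict (mem r) xi.
  apply/funext => z; rewrite /restrict /= inE.
  case: eqP => [->|//] /=; case: ifPn => // ar.
  by case: Hxi => s _; apply: s => xa; apply: h.
have -> : restrict (mem (a :: r)) xi
    = vadd (vscale (xi a) (delta a)) (restrict (mem r) xi).
  apply/funext => z; rewrite /restrict /vadd /vscale /delta /= inE.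
  case: eqP => [->|_] /=; last by rewrite mulr0 add0r.
  by rewrite (negbTE ar) mulr1 addr0.
rewrite Tlin //; last exact: Hsp_delta.
rewrite IH Td //; apply/funext => z; rewrite /vadd /vscale; ring.
Qed.

(** Density argument at one point [z]: if the squared defect there were s > 0, cutting [xi] into a
    finite part and a small tail would bound s by s/2. *)
Lemma bounded_scalar x T (c : C) : bounded_on (Hsp n x) T ->
  (forall w, orb n x w -> T (delta w) = vscale c (delta w)) ->
  forall xi, Hsp n x xi -> T xi = vscale c xi.
Proof.
move=> [Tlin [M TM]] Td xi Hxi; apply/funext => z.
apply/eqP; rewrite -subr_eq0; apply/eqP/sqnorm_eq0.
apply/eqP; rewrite eq_le sqnorm_ge0 andbT leNgt; apply/negP.
set s := sqnorm _ => s0.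
(* The bound [M] may be zero or negative; this larger constant can be divided by. *)
have M0 : 0 < `|M| + 1 by rewrite ltr_wpDl.
have e0 : 0 < s / 2 / (`|M| + 1) by rewrite !divr_gt0.
have [r tl] := l2norm2_tail Hxi.2 e0.
(* Including [z] makes [f] agree with [xi] there, so the defect at [z] comes from the tail [h]
   alone. *)
pose f := restrict (mem (z :: r)) xi.
pose h := restrict (fun t => t \notin z :: r) xi.
have Hf : Hsp n x f by exact: Hsp_restrict.
have Hh : Hsp n x h by exact: Hsp_restrict.
have hl : (l2norm2 h <= (s / 2 / (`|M| + 1))%:E)%E.
  apply: le_trans tl; apply: l2norm2_restrict_sub => t.
  by rewrite inE negb_or => /andP[].
have xiE : xi = vadd (vscale 1 f) h.
  apply/funext => t; rewrite /vadd /vscale /f /h /restrict /=.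
  by case: (t \in z :: r); rewrite mul1r ?addr0 ?add0r.
have sE : s = sqnorm (T h z).
  rewrite /s {1}xiE Tlin.2 // (intertwiner_finite _ Tlin Td Hxi).
  rewrite /vadd /vscale /restrict /= mem_head mul1r; congr sqnorm; ring.
have : (s%:E <= (s / 2)%:E)%E.
  rewrite {1}sE; apply: le_trans (sqnorm_le_l2norm2 (T h) z) _.
  apply: le_trans (TM _ Hh) _.
  apply: (@le_trans _ _ ((`|M| + 1)%:E * l2norm2 h)%E).
    apply: lee_wpmul2r; first exact: l2norm2_ge0.
    by rewrite lee_fin; have := ler_norm M; lra.
  apply: le_trans (lee_wpmul2l _ hl) _; first by rewrite lee_fin ltW.
  by rewrite -EFinM lee_fin mulrC divfK // gt_eqF.
by rewrite lee_fin; lra.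
Qed.

Lemma rho_irreducible x : I01 x -> irreducible n x.
Proof.
move=> x01 T Tb Tg; have [Tlin _] := Tb.
(* The diagonal coefficient of [T] is unchanged along [fmap], since some element of V_n carries [w]
   to [fmap n w]. *)
have step w : orb n x w -> T (delta (fmap n w)) (fmap n w) = T (delta w) w.
  move=> xw; have [w01 _] := xw; have [g gV <-] := inVn_fmap n2 w01.
  have dw := Hsp_delta xw.
  rewrite -rho_delta // Tg // rho_act //.
  exact: Hsp_supp01 (Tlin.1 _ dw).
have steps k w : orb n x w -> orb n x (iter k (fmap n) w) /\
    T (delta (iter k (fmap n) w)) (iter k (fmap n) w) = T (delta w) w.
  move=> xw; elim: k => [//|k [xk ek]] /=.
  by rewrite step //; split => //; exact: orb_fmap.
exists (T (delta x) x); apply: bounded_scalar Tb _ => w xw; apply/funext => z.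
rewrite /vscale /delta; case: eqP => [->|/eqP zw]; last first.
  by rewrite mulr0; exact: intertwiner_delta Tlin Tg xw zw.
(* The forward orbits of [w] and [x] meet, so both coefficients equal the one at the meeting
   point. *)
have [_ [p [q e]]] := xw.
rewrite mulr1 -(steps p w xw).2 e.
exact: (steps q x (orb_refl x01)).2.
Qed.

End Representation.

Theorem theorem4p11 (R : realType) (n : nat) (x y : R) :
  (2 <= n)%N -> I01 x -> I01 y ->
  (unit_equiv n x y <-> orb n x = orb n y) /\ irreducible n x.
Proof.
move=> n2 x01 y01; split; last exact: rho_irreducible.
split=> [|xy]; first exact: unit_equiv_orb.
(* [Hsp] depends on the base point only through its orbit, so the identity serves as the unitary. *)
have := unit_equiv_refl n x.
by rewrite /unit_equiv {2}/Hsp xy.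
Qed.
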